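(* Let $G$ be a diffeological Lie group, let $J\subset\mathbb N$ be finite, let $p\in E^{\mathrm{sph}}(G)$ be a point with support exactly $J$, and let $v\in T_pE^{\mathrm{sph}}(G)$ be a tangent vector with $v_i\neq0$ for some inactive index $i\notin J$. Let $s\mapsto x_i(s)$ be the (smooth) $i$-th spherical coordinate of a smooth curve through $p$ at $s=0$ with velocity $v$, so that $x_i(0)=0$ and $\dot x_i(0)=v_i$. Under the quadratic map $t_i=x_i^2$, the corresponding first-order variation of the Milnor coordinate $t_i$ vanishes, $$\dot t_i(0)=0,$$ and the first nonzero contribution occurs at second order: $$\ddot t_i(0)=2v_i^2 .$$
   Context: A diffeological Lie group is a diffeological group (a group with a diffeology making multiplication and inversion smooth) whose tangent space at the identity carries a compatible Lie algebra structure. Spherical Milnor space: $E^{\mathrm{sph}}(G)$ is the set of families $(x_i,g_i)_{i\in\mathbb N}$ with $x_i\in\mathbb R$ finitely supported, $\sum_i x_i^2=1$, $g_i\in G$, modulo $(x_i,g_i)\sim(x_i,g_i')$ iff $g_i=g_i'$ whenever $x_i\ne0$. It carries the final diffeology generated by the maps $\psi_I:S_I\times G^I\to E^{\mathrm{sph}}(G)$ ($I\subset\mathbb N$ finite, $S_I$ the unit sphere of $\mathbb R^I$), given by extension by zero and passage to the quotient. The support of $p=[(x_i,g_i)]$ is $\{i: x_i\ne0\}$. For a tangent vector $v$ at $p$, the number $v_i$ denotes its component along the spherical coordinate $x_i$. *)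

(* Defs.v *)
From HB Require Import structures.
From mathcomp Require Import all_boot all_order all_algebra.
From mathcomp Require Import finmap.
From mathcomp Require Import all_classical all_reals all_analysis.
Set Implicit Arguments.
Unset Strict Implicit.
Unset Printing Implicit Defensive.
Import Order.TTheory GRing.Theory Num.Theory.
Import numFieldNormedType.Exports.
Local Open Scope classical_set_scope.
Local Open Scope quotient_scope.
Local Open Scope ring_scope.

(** * Smooth maps between open subsets of Euclidean spaces *)

Section Smooth.
Context {R : realType}.

Fixpoint Ck_on (k : nat) n (U : set 'rV[R]_n) (f : 'rV[R]_n -> R) : Prop :=
  match k with
  | 0 => forall x, U x -> {for x, continuous f}
  | k'.+1 => (forall x, U x -> differentiable f x) /\
             (forall j : 'I_n, Ck_on k' U ('D_(delta_mx 0 j) f))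
  end.

Definition smooth_on n (U : set 'rV[R]_n) (f : 'rV[R]_n -> R) : Prop :=
  forall k, Ck_on k U f.

Definition smooth_map_on m n (U : set 'rV[R]_m) (F : 'rV[R]_m -> 'rV[R]_n) :
    Prop :=
  forall j, smooth_on U (fun x => F x 0 j).

Lemma Ck_local k n (U : set 'rV[R]_n) f :
  (forall x, U x -> exists2 V, V x & Ck_on k V f) -> Ck_on k U f.
Proof.
elim: k f => [|k IH] f /= H.
  by move=> x /H[V Vx]; exact.
split=> [x /H[V Vx [+ _]]|j]; first exact.
by apply: IH => x /H[V Vx [_ /(_ j)]]; exists V.
Qed.

Lemma near_open_eq n (U : set 'rV[R]_n) (f g : 'rV[R]_n -> R) x :
  open U -> U x -> (forall y, U y -> f y = g y) ->
  \forall y \near x, f y = g y.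
Proof.
move=> oU Ux fg; have : nbhs x U by exact: open_nbhs_nbhs.
by apply: filterS => y; exact: fg.
Qed.

Lemma differentiable_near0 (V W : normedModType R) (h : V -> W) (x : V) :
  (\forall y \near x, h y = 0) -> differentiable h x.
Proof.
move=> h0; have hx : h x = 0 by exact: (nbhs_singleton h0).
have H : h \o shift x = cst (h x) + (\0 : V -> W) +o_ 0 id.
  apply/eqaddoP => _/posnumP[e].
  move: h0; rewrite (near_shift 0)/=; apply: filterS => y /=.
  rewrite subr0 => hy; rewrite !fctE /= hy hx !(addr0, subr0) normr0.
  by rewrite mulr_ge0.
apply/diff_locallyP.
have -> : ('d h x : _ -> _) = (\0 : V -> W).
  by apply: diff_unique => //; exact: cst_continuous.
by split=> //; exact: cst_continuous.
Qed.

Lemma near_eq_differentiable n (f g : 'rV[R]_n -> R) (x : 'rV[R]_n) :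
  (\forall y \near x, f y = g y) -> differentiable f x -> differentiable g x.
Proof.
move=> fg df; have -> : g = f + (g - f) by rewrite addrC subrK.
apply: differentiableD => //; apply: differentiable_near0.
by move: fg; apply: filterS => y fgy; rewrite !fctE fgy subrr.
Qed.

Lemma near_eq_continuous (V W : topologicalType) (f g : V -> W) x :
  (\forall y \near x, f y = g y) ->
  {for x, continuous f} -> {for x, continuous g}.
Proof.
move=> fg; rewrite /prop_for /continuous_at -(nbhs_singleton fg).
by apply: cvg_trans; exact: near_eq_cvg.
Qed.

Lemma Ck_eq k n (U : set 'rV[R]_n) (f g : 'rV[R]_n -> R) :
  open U -> (forall y, U y -> f y = g y) -> Ck_on k U f -> Ck_on k U g.
Proof.
move=> oU; elim: k f g => [|k IH] f g fg /=.
  move=> cf x Ux; have := cf x Ux.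
  exact: near_eq_continuous (near_open_eq oU Ux fg).
move=> [df Df]; split=> [x Ux|j].
  exact: near_eq_differentiable (near_open_eq oU Ux fg) (df _ Ux).
apply: IH (Df j) => y Uy.
exact: near_eq_derive (near_open_eq oU Uy fg).
Qed.

Lemma Ck_pred k n (U : set 'rV[R]_n) f : Ck_on k.+1 U f -> Ck_on k U f.
Proof.
elim: k f => [|k IH] f [df Df].
  by move=> x Ux; exact: differentiable_continuous (df x Ux).
by split=> // j; exact/IH/Df.
Qed.

Lemma Ck_cst k n (U : set 'rV[R]_n) (a : R) : Ck_on k U (cst a).
Proof.
elim: k a => [|k IH] a /=; first by move=> x _; exact: cst_continuous.
split=> [x _|j]; first exact: differentiable_cst.
rewrite (_ : 'D_ _ _ = cst 0); first exact: IH.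
by apply/funext => x; rewrite derive_cst.
Qed.

Lemma Ck_add k n (U : set 'rV[R]_n) f g :
  open U -> Ck_on k U f -> Ck_on k U g -> Ck_on k U (f + g).
Proof.
move=> oU; elim: k f g => [|k IH] f g.
  by move=> cf cg x Ux; apply: continuousD; [exact: cf|exact: cg].
move=> [df Df] [dg Dg]; split=> [x Ux|j].
  by apply: differentiableD; [exact: df|exact: dg].
apply: (Ck_eq oU _ (IH _ _ (Df j) (Dg j))) => x Ux.
by rewrite deriveD//; apply: diff_derivable; [exact: df|exact: dg].
Qed.

Lemma Ck_mul k n (U : set 'rV[R]_n) f g :
  open U -> Ck_on k U f -> Ck_on k U g -> Ck_on k U (f * g).
Proof.
move=> oU; elim: k f g => [|k IH] f g.
  by move=> cf cg x Ux; apply: continuousM; [exact: cf|exact: cg].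
move=> fk gk; have [df Df] := fk; have [dg Dg] := gk.
split=> [x Ux|j].
  by apply: differentiableM; [exact: df|exact: dg].
have H : Ck_on k U (f * 'D_(delta_mx 0 j) g + g * 'D_(delta_mx 0 j) f).
  by apply: (Ck_add oU); apply: IH;
    [exact: (Ck_pred fk)|exact: Dg|exact: (Ck_pred gk)|exact: Df].
apply: (Ck_eq oU _ H) => x Ux.
by rewrite deriveM//; apply: diff_derivable; [exact: df|exact: dg].
Qed.

Lemma Ck_sum k n (U : set 'rV[R]_n) m (f : 'I_m -> 'rV[R]_n -> R) :
  open U -> (forall i, Ck_on k U (f i)) -> Ck_on k U (\sum_(i < m) f i).
Proof.
move=> oU fk; elim/big_ind : _ => //; first exact: Ck_cst.
by move=> *; exact: Ck_add.
Qed.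

Lemma rV_sum_coord m n (F : 'rV[R]_m -> 'rV[R]_n) :
  F = \sum_(j < n) (fun x => F x 0 j *: delta_mx 0 j).
Proof. by apply/funext => x; rewrite fct_sumE -row_sum_delta. Qed.

Lemma differentiable_rV m n (F : 'rV[R]_m -> 'rV[R]_n) x :
  (forall j, differentiable (fun y => F y 0 j) x) -> differentiable F x.
Proof.
move=> dF; rewrite (rV_sum_coord F); apply: differentiable_sum => j.
exact: differentiableZl.
Qed.

Lemma continuous_rV m n (F : 'rV[R]_m -> 'rV[R]_n) x :
  (forall j, {for x, continuous (fun y => F y 0 j)}) -> {for x, continuous F}.
Proof.
move=> cF; rewrite (rV_sum_coord F).
elim/big_ind : _ => [|f g cf cg|j _]; first exact: cst_continuous.
  exact: continuousD.
exact: continuousZr_tmp.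
Qed.

Lemma derive_comp_rV m n (F : 'rV[R]_m -> 'rV[R]_n) (g : 'rV[R]_n -> R) x v :
  (forall j, differentiable (fun y => F y 0 j) x) -> differentiable g (F x) ->
  'D_v (g \o F) x =
  \sum_(j < n) 'D_(delta_mx 0 j) g (F x) * 'D_v (fun y => F y 0 j) x.
Proof.
move=> dF dg; have dFx := differentiable_rV dF.
rewrite deriveE; last exact: differentiable_comp.
rewrite diff_comp//= [X in 'd g _ X]row_sum_delta linear_sum/=.
apply: eq_bigr => j _; rewrite linearZ/= mulrC (deriveE _ dg); congr (_ * _).
rewrite deriveE//.
have @p : {linear 'rV[R]_n -> R}.
  by exists (fun N : 'rV[R]_n => N 0 j); do 2![eexists]; do ?[constructor];
     rewrite ?mxE// => ? *; rewrite ?mxE//; move=> ?; rewrite !mxE.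
have pc : continuous p by exact: coord_continuous.
have := diff_comp dFx (linear_differentiable (F x) pc).
by rewrite diff_lin// => /(congr1 (@^~ v)) /= ->.
Qed.

Lemma Ck_comp k m n (U : set 'rV[R]_n) (V : set 'rV[R]_m) g
    (F : 'rV[R]_m -> 'rV[R]_n) :
  open V -> (forall y, V y -> U (F y)) ->
  Ck_on k U g -> (forall j, Ck_on k V (fun y => F y 0 j)) ->
  Ck_on k V (g \o F).
Proof.
move=> oV VU; elim: k g => [|k IH] g.
  move=> cg cF x Vx; apply: continuous_comp.
    by apply: continuous_rV => j; exact: cF.
  exact/cg/VU.
move=> [dg Dg] Fk; split=> [x Vx|i].
  apply: differentiable_comp; last exact/dg/VU.
  by apply: differentiable_rV => j; have [dF _] := Fk j; exact: dF.
have H : Ck_on k V (\sum_(j < n) (('D_(delta_mx 0 j) g \o F) *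
                        'D_(delta_mx 0 i) (fun y => F y 0 j))).
  apply: Ck_sum => // j; apply: Ck_mul => //; last by have [_ DF] := Fk j; exact: DF.
  by apply: IH => [|l]; [exact: Dg|exact: (Ck_pred (Fk l))].
apply: (Ck_eq oV _ H) => x Vx.
rewrite derive_comp_rV ?fct_sumE//; last exact/dg/VU.
by move=> j; have [dF _] := Fk j; exact: dF.
Qed.

End Smooth.

(** * Diffeologies *)

#[local] Obligation Tactic := idtac.

Section Diffeology.
Context {R : realType}.

(* A parametrization with domain [U] is represented by a total function of
   which only the restriction to [U] matters ([plot_eq]). *)
Record diffeology (X : Type) := Diffeology {
  plot : forall n, set 'rV[R]_n -> ('rV[R]_n -> X) -> Prop;
  plot_open : forall n (U : set 'rV[R]_n) P, plot U P -> open U;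
  plot_eq : forall n (U : set 'rV[R]_n) P Q,
    (forall u, U u -> P u = Q u) -> plot U P -> plot U Q;
  plot_cst : forall n (U : set 'rV[R]_n) x, open U -> plot U (fun=> x);
  plot_local : forall n (U : set 'rV[R]_n) P, open U ->
    (forall u, U u -> exists V, [/\ V u, V `<=` U & plot V P]) -> plot U P;
  plot_comp : forall m n (U : set 'rV[R]_n) (V : set 'rV[R]_m) P F,
    plot U P -> open V -> smooth_map_on V F -> (forall v, V v -> U (F v)) ->
    plot V (P \o F)
}.

Definition smooth X Y (DX : diffeology X) (DY : diffeology Y) (f : X -> Y) :
    Prop :=
  forall n (U : set 'rV[R]_n) P, plot DX U P -> plot DY U (f \o P).

Program Definition std_diffeology : diffeology R :=
  @Diffeology R (fun n U P => open U /\ smooth_on U P) _ _ _ _ _.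
Next Obligation. by move=> n U P []. Qed.
Next Obligation.
by move=> n U P Q PQ [oU sP]; split=> // k; exact: Ck_eq (sP k).
Qed.
Next Obligation. by move=> n U x oU; split=> // k; exact: Ck_cst. Qed.
Next Obligation.
move=> n U P oU PU; split=> // k; apply: Ck_local => u /PU[V [Vu _ [_ sP]]].
by exists V; [exact: Vu|exact: sP].
Qed.
Next Obligation.
move=> m n U V P F [oU sP] oV sF FVU; split=> // k.
by apply: (Ck_comp oV FVU (sP k)) => j; exact: sF.
Qed.

Program Definition pullback_diffeology X Y (f : X -> Y) (D : diffeology Y) :
    diffeology X :=
  @Diffeology X (fun n U P => plot D U (f \o P)) _ _ _ _ _.
Next Obligation. by move=> X Y f D n U P; exact: plot_open. Qed.
Next Obligation.
by move=> X Y f D n U P Q PQ; apply: plot_eq => u Uu /=; rewrite PQ.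
Qed.
Next Obligation. by move=> X Y f D n U x; exact: plot_cst. Qed.
Next Obligation. by move=> X Y f D n U P; exact: plot_local. Qed.
Next Obligation. by move=> X Y f D m n U V P F; exact: plot_comp. Qed.

Definition subset_diffeology X (A : X -> Prop) (D : diffeology X) :
    diffeology {x | A x} :=
  pullback_diffeology (@proj1_sig X A) D.

Program Definition prod_diffeology X Y (DX : diffeology X) (DY : diffeology Y) :
    diffeology (X * Y) :=
  @Diffeology (X * Y)
    (fun n U P => plot DX U (fst \o P) /\ plot DY U (snd \o P)) _ _ _ _ _.
Next Obligation. by move=> X Y DX DY n U P [+ _]; exact: plot_open. Qed.
Next Obligation.
move=> X Y DX DY n U P Q PQ [P1 P2].
by split; [apply: plot_eq P1|apply: plot_eq P2] => u Uu /=; rewrite PQ.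
Qed.
Next Obligation. by move=> X Y DX DY n U x oU; split; exact: plot_cst. Qed.
Next Obligation.
move=> X Y DX DY n U P oU PU.
by split; apply: plot_local => // u /PU[V [Vu VU [? ?]]]; exists V.
Qed.
Next Obligation.
move=> X Y DX DY m n U V P F [P1 P2] oV sF FVU.
by split; [exact: plot_comp P1 oV sF FVU|exact: plot_comp P2 oV sF FVU].
Qed.

Program Definition power_diffeology (I : Type) X (D : diffeology X) :
    diffeology (I -> X) :=
  @Diffeology (I -> X)
    (fun n U P => open U /\ forall i, plot D U (fun u => P u i)) _ _ _ _ _.
Next Obligation. by move=> I X D n U P []. Qed.
Next Obligation.
move=> I X D n U P Q PQ [oU Pi].
by split=> // i; apply: plot_eq (Pi i) => u Uu /=; rewrite PQ.
Qed.
Next Obligation. by move=> I X D n U x oU; split=> // i; exact: plot_cst. Qed.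
Next Obligation.
move=> I X D n U P oU PU; split=> // i.
by apply: plot_local => // u /PU[V [Vu VU [_ Pi]]]; exists V.
Qed.
Next Obligation.
move=> I X D m n U V P F [oU Pi] oV sF FVU.
by split=> // i; exact: plot_comp (Pi i) oV sF FVU.
Qed.

(* The finest diffeology on [X] for which every [psi k] is smooth, i.e. the
   intersection of all such diffeologies. *)
Program Definition final_diffeology (K : Type) (Y : K -> Type)
    (DY : forall k, diffeology (Y k)) X (psi : forall k, Y k -> X) :
    diffeology X :=
  @Diffeology X (fun n U P => open U /\
    forall D : diffeology X, (forall k, smooth (DY k) D (psi k)) ->
      plot D U P) _ _ _ _ _.
Next Obligation. by move=> K Y DY X psi n U P []. Qed.
Next Obligation.
by move=> K Y DY X psi n U P Q PQ [oU H]; split=> // D /H; exact: plot_eq.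
Qed.
Next Obligation.
by move=> K Y DY X psi n U x oU; split=> // D _; exact: plot_cst.
Qed.
Next Obligation.
move=> K Y DY X psi n U P oU PU; split=> // D HD.
apply: plot_local => // u /PU[V [Vu VU [_ /(_ D HD) VP]]].
by exists V.
Qed.
Next Obligation.
move=> K Y DY X psi m n U V P F [oU H] oV sF FVU.
by split=> // D /H DP; exact: plot_comp DP oV sF FVU.
Qed.

(** * Tangent spaces *)

Record smooth_fun X (D : diffeology X) := SmoothFun {
  smooth_fun_val :> X -> R;
  smooth_funP : smooth D std_diffeology smooth_fun_val
}.

Definition smooth_curve X (D : diffeology X) (I : set R) (c : R -> X) : Prop :=
  plot D [set u : 'rV[R]_1 | I (u 0 0)] (fun u => c (u 0 0)).

Definition curve_at X (D : diffeology X) (p : X) (c : R -> X) : Prop :=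
  c 0 = p /\ exists2 I : set R, I 0 & smooth_curve D I c.

(* A tangent vector is the derivation of smooth functions that it induces;
   two curves through a point thus have the same velocity if and only if they
   give the same derivative at 0 to every smooth function. *)
Definition derivation X (D : diffeology X) := smooth_fun D -> R^o.

Definition velocity X (D : diffeology X) (c : R -> X) : derivation D :=
  fun f => (f \o c)^`()%classic 0.
Arguments velocity {X} D c _.

Definition tangent_space X (D : diffeology X) (p : X) : set (derivation D) :=
  [set v | exists n (a : 'I_n -> R) (c : 'I_n -> R -> X),
    (forall k, curve_at D p (c k)) /\ v = \sum_(k < n) a k *: velocity D (c k)].

End Diffeology.

Arguments velocity {R X} D c _.
Arguments tangent_space {R X} D p _.
Arguments diffeology R X : clear implicits.
Arguments std_diffeology R : clear implicits.

(** * Diffeological Lie groups *)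

Section LieGroup.
Context {R : realType}.

Definition is_diffeological_group (G : groupType) (D : diffeology R G) : Prop :=
  smooth (prod_diffeology D D) D (fun xy => xy.1 * xy.2)%g /\
  smooth D D (fun x => x^-1)%g.

Record is_lie_bracket (V : lmodType R) (T : set V) (br : V -> V -> V) : Prop := {
  lie_closed : forall u v, T u -> T v -> T (br u v);
  lie_linearl : forall a u v w, T u -> T v -> T w ->
    br (a *: u + v) w = a *: br u w + br v w;
  lie_linearr : forall a u v w, T u -> T v -> T w ->
    br w (a *: u + v) = a *: br w u + br w v;
  lie_alternating : forall u, T u -> br u u = 0;
  lie_jacobi : forall u v w, T u -> T v -> T w ->
    br u (br v w) + br v (br w u) + br w (br u v) = 0
}.

(* The bracket is the derivative at the identity of the adjoint action
   [Ad_g [d] = [s |-> g d(s) g^-1]] of the group on its tangent space. *)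
Definition bracket_compatible (G : groupType) (D : diffeology R G)
    (br : derivation D -> derivation D -> derivation D) : Prop :=
  forall c d, curve_at D 1%g c -> curve_at D 1%g d -> forall f : smooth_fun D,
    br (velocity D c) (velocity D d) f =
    (fun t => velocity D (fun s => c t * d s * (c t)^-1)%g f)^`()%classic 0.

Record diffLieGroup := DiffLieGroup {
  dlg_sort :> groupType;
  dlg_diff : diffeology R dlg_sort;
  dlg_group : is_diffeological_group dlg_diff;
  dlg_bracket : derivation dlg_diff -> derivation dlg_diff ->
    derivation dlg_diff;
  dlg_lie : is_lie_bracket (tangent_space dlg_diff 1%g) dlg_bracket;
  dlg_compatible : bracket_compatible dlg_bracket
}.

End LieGroup.

Arguments diffLieGroup R : clear implicits.

(** * The spherical Milnor space *)

Section SphericalMilnor.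
Context {R : realType} (G : groupType).

Record milnor_family := MilnorFamily {
  mf_x : nat -> R;
  mf_g : nat -> G;
  mf_finite : finite_set [set i | mf_x i != 0];
  mf_sphere : \sum_(i \in [set: nat]) mf_x i ^+ 2 = 1
}.

HB.instance Definition _ := gen_eqMixin milnor_family.
HB.instance Definition _ := gen_choiceMixin milnor_family.

Definition milnor_eq (a b : milnor_family) : bool :=
  `[< mf_x a = mf_x b /\ forall i, mf_x a i != 0 -> mf_g a i = mf_g b i >].

Lemma milnor_eq_refl : reflexive milnor_eq.
Proof. by move=> a; apply/asboolP. Qed.

Lemma milnor_eq_sym : symmetric milnor_eq.
Proof.
suff H a b : milnor_eq a b -> milnor_eq b a by move=> a b; apply/idP/idP => /H.
by move=> /asboolP[xab gab]; apply/asboolP; split=> // i; rewrite -xab => /gab.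
Qed.

Lemma milnor_eq_trans : transitive milnor_eq.
Proof.
move=> b a c /asboolP[xab gab] /asboolP[xbc gbc]; apply/asboolP.
split=> [|i ai]; first by rewrite xab.
by rewrite gab// gbc// -xab.
Qed.

Canonical milnor_equiv :=
  EquivRel milnor_eq milnor_eq_refl milnor_eq_sym milnor_eq_trans.

Definition Esph := {eq_quot milnor_equiv}.

Definition sphere (I : {fset nat}) : Type :=
  {x : I -> R | \sum_(i : I) x i ^+ 2 = 1}.

Definition extension (I : {fset nat}) T (a : T) (x : I -> T) : nat -> T :=
  fun i => if insub i is Some j then x j else a.

Lemma extension_finite (I : {fset nat}) (x : I -> R) :
  finite_set [set i | extension 0 x i != 0].
Proof.
apply: (sub_finite_set _ (finite_fset I)) => i /=.
by rewrite /extension; case: insubP => [j jI _ _ //|_]; rewrite eqxx.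
Qed.

Lemma extension_sphere (I : {fset nat}) (x : sphere I) :
  \sum_(i \in [set: nat]) extension 0 (proj1_sig x) i ^+ 2 = 1.
Proof.
case: x => x /= <-; rewrite -(@fsbig_widen _ _ _ _ [set` I])//; last first.
  move=> i [_ /= iI]; rewrite /extension insubF ?expr0n//.
  exact/negbTE/negP.
rewrite -fsbig_seq ?fset_uniq// big_seq_fsetE/=.
by apply: eq_bigr => i _; rewrite /extension valK.
Qed.

Definition psi (I : {fset nat}) (xg : sphere I * (I -> G)) : Esph :=
  \pi_Esph (MilnorFamily (extension 1%g xg.2) (extension_finite (proj1_sig xg.1))
             (extension_sphere xg.1)).

Definition sphere_diffeology (I : {fset nat}) : diffeology R (sphere I) :=
  subset_diffeology (fun x : I -> R => \sum_(i : I) x i ^+ 2 = 1)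
    (power_diffeology I (std_diffeology R)).

Definition Esph_diffeology (D : diffeology R G) : diffeology R Esph :=
  final_diffeology
    (fun I : {fset nat} =>
       prod_diffeology (sphere_diffeology I) (power_diffeology I D)) psi.

Definition sph_coord (i : nat) (p : Esph) : R := mf_x (repr p) i.

Lemma sph_coord_pi i (a : milnor_family) : sph_coord i (\pi_Esph a) = mf_x a i.
Proof.
rewrite /sph_coord; case: piP => b /eqmodP /asboolP[-> //].
Qed.

Definition milnor_support (p : Esph) : set nat := [set i | sph_coord i p != 0].

Lemma smooth_sph_coord (D : diffeology R G) i :
  smooth (Esph_diffeology D) (std_diffeology R) (sph_coord i).
Proof.
move=> n U P [oU] /(_ (pullback_diffeology (sph_coord i) (std_diffeology R))).
apply=> I m V Q [[oV Q1] _]; rewrite /pullback_diffeology/=.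
have -> : sph_coord i \o (@psi I \o Q) =
    (fun u => extension 0 (proj1_sig (Q u).1) i).
  by apply/funext => u /=; rewrite sph_coord_pi.
rewrite /extension; case: insubP => [j _ _|_]; first exact: Q1 j.
exact: (plot_cst (std_diffeology R)).
Qed.

Definition sph_coord_fun (D : diffeology R G) (i : nat) :
    smooth_fun (Esph_diffeology D) := SmoothFun (@smooth_sph_coord D i).

(* The component [v_i] of a tangent vector, i.e. the value at [v] of the
   differential of the [i]-th spherical coordinate. *)
Definition tangent_coord (D : diffeology R G) (i : nat)
    (v : derivation (Esph_diffeology D)) : R := v (sph_coord_fun D i).

End SphericalMilnor.

Arguments Esph R G : clear implicits.

(* Main.v *)
Require Import Defs.
From HB Require Import structures.
From mathcomp Require Import all_boot all_order all_algebra.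
From mathcomp Require Import finmap.
From mathcomp Require Import all_classical all_reals all_analysis.
Import Order.TTheory GRing.Theory Num.Theory.
Import numFieldNormedType.Exports.
Local Open Scope classical_set_scope.
Local Open Scope ring_scope.

(** A spherical coordinate is a smooth function on the Milnor space, so along
    the curve [c] it is a smooth real function [x] near 0
    ([smooth_sph_coord]), and by definition of the velocity its derivative at 0
    is the component [v_i]. Since [i] is inactive at [p], [x] vanishes at 0.
    The rest is calculus: [(x^2)' = 2 x x'] vanishes wherever [x] does, and
    [(x^2)'' = 2 x'^2 + 2 x x''] reduces to [2 x'^2] there
    ([is_derive_sqr], [is_derive_derive1_sqr]).

    What has to be bridged is that smoothness of plots is phrased with
    directional derivatives on [1 x 1] row vectors, whereas the theorem speaks
    of functions of a real variable. The difference quotients of [f] at [s] and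
    of [u |-> f (u 0 0)] at the row vector [s] are the same function, hence so
    are the derivatives, and the identification can be iterated
    ([derive1_row], [smooth_curve_derive1]). *)

Section RowCurve.
Context {R : realType}.
Implicit Types (f : R -> R) (s : R) (I : set R).

Lemma row_difference_quotient f (u : 'rV[R]_1) :
  (fun h : R => h^-1 *: (f ((h *: delta_mx 0 0 + u) 0 0) - f (u 0 0))) =
  (fun h : R => h^-1 *: (f (h *: 1 + u 0 0) - f (u 0 0))).
Proof. by apply/funext => h; rewrite !mxE /= mulr1 -[h *: 1]/(h * 1) mulr1. Qed.

Lemma derivable_row {f} {u : 'rV[R]_1} :
  derivable (fun w : 'rV[R]_1 => f (w 0 0)) u (delta_mx 0 0) ->
  derivable f (u 0 0) 1.
Proof. by rewrite /derivable row_difference_quotient. Qed.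

(** The equality holds without differentiability, both sides being the limit of
    one and the same difference quotient; it can therefore be used on whole
    functions, and again on the derivative. *)
Lemma derive1_row f :
  'D_(delta_mx 0 0) (fun u : 'rV[R]_1 => f (u 0 0)) =
  (fun u : 'rV[R]_1 => f^`()%classic (u 0 0)).
Proof.
by apply/funext => u; rewrite derive1E /derive row_difference_quotient.
Qed.

Lemma smooth_curve_derivable {I f s} :
  smooth_curve (std_diffeology R) I f -> I s -> derivable f s 1.
Proof.
move=> [_ /(_ 1%N)[df _]] Is.
have Iu : I ((const_mx s : 'rV[R]_1) 0 0) by rewrite mxE.
have /(diff_derivable (v := delta_mx 0 0))/derivable_row := df _ Iu.
by rewrite mxE.
Qed.

Lemma smooth_curve_derive1 {I f} :
  smooth_curve (std_diffeology R) I f ->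
  smooth_curve (std_diffeology R) I f^`()%classic.
Proof.
move=> [oI sf]; split=> // k; have [_ /(_ 0)] := sf k.+1.
by rewrite derive1_row.
Qed.

(** Openness of the domain of a plot is known for row vectors; it is pulled
    back to the real line along the continuous map [r |-> const_mx r]. *)
Lemma smooth_curve_nbhs {X : Type} {D : diffeology R X} {I} {c : R -> X} {s} :
  smooth_curve D I c -> I s -> \forall r \near s, I r.
Proof.
move=> /plot_open oI Is.
have cont : continuous (fun r : R => const_mx r : 'rV[R]_1).
  move=> r.
  rewrite (_ : (fun r => _) = (fun r : R => r *: (const_mx 1 : 'rV[R]_1))).
    exact: scalel_continuous.
  by apply/funext => a; apply/matrixP => i j; rewrite !mxE mulr1.
have : open [set r : R | I ((const_mx r : 'rV[R]_1) 0 0)].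
  by move/continuousP: cont => /(_ _ oI).
rewrite openE => /(_ s); rewrite /= mxE => /(_ Is).
by apply: filterS => r; rewrite /= mxE.
Qed.

Lemma is_derive_sqr {f s} : derivable f s 1 ->
  is_derive s 1 (fun r => f r ^+ 2) (2 * f s * f^`()%classic s).
Proof.
move=> df; have fs : is_derive s 1 f (f^`()%classic s).
  by rewrite derive1E; exact/derivableP.
rewrite (_ : (fun r => f r ^+ 2) = f * f); last first.
  by apply/funext => r; rewrite expr2.
apply: is_derive_eq.
by rewrite /GRing.scale /= -mulrA mulr_natl mulr2n.
Qed.

(** [f] is required to be derivable around [s], not just at [s], because the
    derivative of [f^2] is replaced by [2 f f'], which must agree with it on a
    neighbourhood of [s] before it can be differentiated. *)
Lemma is_derive_derive1_sqr {f s} :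
  (\forall r \near s, derivable f r 1) -> derivable f^`()%classic s 1 ->
  is_derive s 1 (fun r => f r ^+ 2)^`()%classic
    (2 * f^`()%classic s ^+ 2 + 2 * f s * f^`()^`()%classic s).
Proof.
move=> df ddf; have dfs := nbhs_singleton df.
have fs : is_derive s 1 f (f^`()%classic s).
  by rewrite derive1E; exact/derivableP.
have f's : is_derive s 1 f^`()%classic (f^`()^`()%classic s).
  by rewrite [in X in is_derive _ _ _ X]derive1E; exact/derivableP.
apply: (@near_eq_is_derive _ _ _ (2 *: (f * f^`()%classic))).
  apply: filterS df => r dfr.
  rewrite derive1E (derive_val (is_derive := is_derive_sqr dfr)).
  by rewrite -[RHS]mulrA.
apply: is_derive_eq; rewrite /GRing.scale /= mulrDr addrC expr2.
by rewrite !mulrA.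
Qed.

End RowCurve.

Theorem theorem5p24 (R : realType) (G : diffLieGroup R) (J : {fset nat})
    (p : Esph R G) (hp : milnor_support p = [set` J])
    (v : derivation (Esph_diffeology (dlg_diff G)))
    (hv : tangent_space (Esph_diffeology (dlg_diff G)) p v)
    (i : nat) (hi : i \notin J) (hvi : tangent_coord i v != 0)
    (c : R -> Esph R G) (I : set R) (hI : I 0)
    (hc : smooth_curve (Esph_diffeology (dlg_diff G)) I c)
    (hc0 : c 0 = p) (hcv : velocity (Esph_diffeology (dlg_diff G)) c = v) :
  let x : R -> R := fun s => sph_coord i (c s) in
  let t : R -> R := fun s => x s ^+ 2 in
  [/\ smooth_curve (std_diffeology R) I x,
      x 0 = 0 /\ is_derive (0 : R) 1 x (tangent_coord i v),
      is_derive (0 : R) 1 t 0,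
      is_derive (0 : R) 1 (derive1 t) (2 * tangent_coord i v ^+ 2) &
      2 * tangent_coord i v ^+ 2 != 0].
Proof.
move=> x t.
have sx : smooth_curve (std_diffeology R) I x.
  exact: (@smooth_sph_coord _ _ (dlg_diff G) i _ _ _ hc).
have x0 : x 0 = 0.
  apply/eqP; apply: contraNT hi => x0.
  have : milnor_support p i by rewrite -hc0.
  by rewrite hp.
(* The velocity evaluated at a smooth function is the derivative along [c]. *)
have dx : x^`()%classic 0 = tangent_coord i v by rewrite -hcv.
have x_derivable : \forall s \near (0 : R), derivable x s 1.
  apply: filterS (smooth_curve_nbhs sx hI) => s.
  exact: smooth_curve_derivable sx.
have x'_derivable : derivable x^`()%classic 0 1.
  exact: smooth_curve_derivable (smooth_curve_derive1 sx) hI.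
have dx0 := nbhs_singleton x_derivable.
split=> //.
- by split=> //; rewrite -dx derive1E; exact/derivableP.
- by have := is_derive_sqr dx0; rewrite x0 mulr0 mul0r.
- have := is_derive_derive1_sqr x_derivable x'_derivable.
  by rewrite x0 mulr0 mul0r addr0 dx.
- by rewrite mulf_neq0 ?pnatr_eq0// expf_neq0.
Qed.
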